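(* Let $(X_n)_{n\ge 0}$, $X_n=\Psi_n\circ\dots\circ\Psi_1(X_0)$, be an iterated function system (IFS) of iid Lipschitz maps $\Psi_1,\Psi_2,\dots$ on $(\mathbb{X},d)$ with a (not necessarily unique) stationary law $\pi$, and let $x_0\in\mathbb{X}$. Suppose there exist a set $I\subset\mathbb{R}$ with $[0,\infty)\subset I$ and nondecreasing continuous random functions $F_n,G_n:I\to I$, $n\ge 1$, such that (C1) the triples $(\Psi_n,F_n,G_n)$, $n\ge 1$, are iid and independent of $X_0$; (C2) $F_n(d(x_0,x))\le d(x_0,\Psi_n(x))\le G_n(d(x_0,x))$ a.s. for all $x\in\mathbb{X}$ and $n\ge 1$. Suppose further that the IFS generated by $(F_n)_{n\ge 1}$ and by $(G_n)_{n\ge 1}$ are both contractive with almost sure backward limits $\widehat{Y}_\infty$, $\widehat{Z}_\infty$, respectively, and unique stationary laws $\pi_F,\pi_G$ having tail indices $\vartheta_F$ and $\vartheta_G$, respectively. Let $X_0$ have law $\pi$. Then $$\mathbb{P}(\widehat{Y}_\infty>t)\ \le\ \mathbb{P}(d(x_0,X_0)>t)\ \le\ \mathbb{P}(\widehat{Z}_\infty>t)\quad\text{for all }t\ge 0,$$ and, if moreover $(X_n)_{n\ge 0}$ is contractive with a.s. backward limit $\widehat{X}_\infty$, then $$\widehat{Y}_\infty\ \le\ d(x_0,\widehat{X}_\infty)\ \le\ \widehat{Z}_\infty\quad\text{a.s.}$$ Furthermore, the lower tail index $\vartheta_*$ and the upper tail index $\vartheta^*$ of the law of $d(x_0,X_0)$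 satisfy $$\vartheta_G\ \le\ \vartheta_*\ \le\ \vartheta^*\ \le\ \vartheta_F.$$ Finally, if $\vartheta_F=\vartheta_G=:\vartheta$ is the exact tail index of both $\pi_F$ and $\pi_G$, then $\vartheta$ is also the exact tail index of the law of $d(x_0,X_0)$.
   Context: $(\mathbb{X},d)$ is a complete separable metric space with unbounded metric $d$. An IFS of iid Lipschitz maps is a Markov chain $X_n=\Psi_n(X_{n-1})$, $n\ge1$, where $\Psi_n=\Psi(\theta_n,\cdot)$, the random elements $\theta_1,\theta_2,\dots$ are iid with values in a measurable space $\Theta$ and independent of $X_0$, and $\Psi:\Theta\times\mathbb{X}\to\mathbb{X}$ is jointly measurable and Lipschitz in its second argument for every $\theta$. A law $\pi$ on $\mathbb{X}$ is stationary if $X_0\sim\pi$ implies $X_1\sim\pi$. ''A.s. for all $x$ and $n$'' means outside one null set the statement holds for all $x$ and $n$. For a Lipschitz map $\psi$ let $L(\psi)=\sup_{x\ne y}d(\psi(x),\psi(y))/d(x,y)$. An IFS generated by iid Lipschitz maps $\Psi_1,\Psi_2,\dots$ (generic copy $\Psi$) is called contractive if $\lim_{n\to\infty}\frac1n\log L(\Psi_n\circ\dots\circ\Psi_1)<0$ a.s., where it is understood that $\mathbb{E}\log^+L(\Psi)<\infty$ and $\mathbb{E}\log^+d(x_0,\Psi(x_0))<\infty$ for some (hence all) $x_0$. In that case the backward iterations $\Psi_1\circ\dots\circ\Psi_n(x)$ converge a.s., for every $x$, to a limit not depending on $x$ (the a.s. backward limit), whose law is the unique stationary law. The same terminology is used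 for the IFS generated by $(F_n)$ and $(G_n)$ on $I$ with the usual distance. Tail indices (at $+\infty$) of a real random variable $Y$ or of its law: the lower tail index is $\vartheta_*$ if $\limsup_{x\to\infty}\frac{\log \mathbb{P}(Y>x)}{\log x}=-\vartheta_*<0$; the upper tail index is $\vartheta^*$ if $\liminf_{x\to\infty}\frac{\log \mathbb{P}(Y>x)}{\log x}=-\vartheta^*>-\infty$; the tail index is $\vartheta$ if $\vartheta_*=\vartheta^*=\vartheta\in(0,\infty)$; $\vartheta\in(0,\infty)$ is the exact tail index if $0<\liminf_{x\to\infty}x^{\vartheta}\mathbb{P}(Y>x)\le\limsup_{x\to\infty}x^{\vartheta}\mathbb{P}(Y>x)<\infty$. *)

(* Defs.v *)
From HB Require Import structures.
From mathcomp Require Import all_boot all_order all_algebra finmap.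
From mathcomp Require Import all_classical all_reals all_analysis.

Set Implicit Arguments.
Unset Strict Implicit.
Unset Printing Implicit Defensive.

Import Order.TTheory GRing.Theory Num.Theory.
Import numFieldNormedType.Exports.

Local Open Scope classical_set_scope.
Local Open Scope ring_scope.

#[short(type="completeMetricType")]
HB.structure Definition CompleteMetric (R : realType) :=
  {T of Complete T & Metric R T}.

Definition separable (T : topologicalType) : Prop :=
  exists2 S : set T, countable S & dense S.

Definition unbounded_metric (R : realType) (X : metricType R) : Prop :=
  forall M : R, exists x y : X, M < mdist x y.

Definition is_lipschitz (R : realType) (X : metricType R) (psi : X -> X) :
    Prop :=
  exists k : R, forall x y, mdist (psi x) (psi y) <= k * mdist x y.

Notation borel X := (g_sigma_algebraType (@open X)).

(* A random self-map of [D] (resp. of the whole space, for [D = setT]) is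
   encoded by a random function defined on the ambient type, whose values
   outside [D] are irrelevant: the sigma-algebra on functions is generated by
   the evaluations at the points of [D] only. *)
Definition evaluations (A : Type) (D : set A) d (B : measurableType d) :
    set (set (A -> B)) :=
  \bigcup_(a in D) preimage_set_system setT (fun f : A -> B => f a) measurable.

Notation random_map_space D B := (g_sigma_algebraType (@evaluations _ D _ B)).

Section independence.
Context {R : realType} {d} {Omega : measurableType d} (P : probability Omega R).
Context {d'} {S : measurableType d'}.
Local Open Scope ereal_scope.

Definition sigma_of (X : Omega -> S) : set (set Omega) :=
  preimage_set_system setT X measurable.

Definition mutually_independent (A : nat -> set (set Omega)) : Prop :=
  forall (J : {fset nat}) (E : nat -> set Omega),
    (forall j, j \in J -> A j (E j)) ->
    P (\bigcap_(j in [set` J]) E j) = \prod_(j <- J) P (E j).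

Definition iid (X : nat -> Omega -> S) : Prop :=
  [/\ forall n, measurable_fun setT (X n),
      forall n B, measurable B -> P (X n @^-1` B) = P (X 0%N @^-1` B) &
      mutually_independent (fun n => sigma_of (X n))].

(* the whole sequence [X] is independent of [Y] *)
Definition seq_independent_of d2 (S2 : measurableType d2)
    (X : nat -> Omega -> S) (Y : Omega -> S2) : Prop :=
  forall E B, <<s \bigcup_n sigma_of (X n) >> E -> measurable B ->
    P (E `&` Y @^-1` B) = P E * P (Y @^-1` B).

End independence.

Section ifs.
Context {R : realType} {d} {Omega : measurableType d} (P : probability Omega R).
Local Open Scope ereal_scope.

(* A law on [D], where [D] is a subset of [T], is encoded as a law on [T]
   carried by [D]. Stationarity is expressed on the product space carrying
   [X_0 = z.1] with law [pi] and, independently, the random map [Phi z.2];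
   for [B = setT], it entails in particular that [pi] is carried by [D]. *)
Definition stationary_law d' (T : measurableType d') (D : set T)
    (Phi : Omega -> T -> T) (pi : probability T R) : Prop :=
  forall B, measurable B ->
    (pi \x P) [set z | D z.1 /\ B (Phi z.2 z.1)] = pi B.

Definition unique_stationary_law d' (T : measurableType d') (D : set T)
    (Phi : Omega -> T -> T) (pi : probability T R) : Prop :=
  stationary_law D Phi pi /\
  forall pi' : probability T R, stationary_law D Phi pi' ->
    forall B, measurable B -> pi' B = pi B.

(* Sequences of maps start at index 0: [Phi 0], [Phi 1], etc. are the maps usually
   numbered 1, 2, etc. *)

Fixpoint forward_iter (T : Type) (Phi : nat -> T -> T) (n : nat) : T -> T :=
  if n is m.+1 then Phi m \o forward_iter Phi m else id.

Fixpoint backward_iter (T : Type) (Phi : nat -> T -> T) (n : nat) : T -> T :=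
  if n is m.+1 then backward_iter Phi m \o Phi m else id.

Definition lip_const (T : Type) (dist : T -> T -> R) (D : set T)
    (psi : T -> T) : \bar R :=
  ereal_sup [set r | exists x y,
    [/\ D x, D y, x <> y & r = (dist (psi x) (psi y) / dist x y)%:E]].

Definition log_plus (x : \bar R) : \bar R := maxe 0 (lne x).

Definition contractive (T : Type) (dist : T -> T -> R) (D : set T)
    (Phi : nat -> Omega -> T -> T) : Prop :=
  [/\ \int[P]_w log_plus (lip_const dist D (Phi 0%N w)) < +oo,
      exists2 x, D x & \int[P]_w log_plus (dist x (Phi 0%N w x))%:E < +oo &
      {ae P, forall w, exists2 l : \bar R, l < 0 &
        (n%:R^-1)%:E *
          lne (lip_const dist D (forward_iter (fun k => Phi k w) n))
        @[n --> \oo] --> l}].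

Definition backward_limit (T : topologicalType) (D : set T)
    (Phi : nat -> Omega -> T -> T) (Z : Omega -> T) : Prop :=
  forall x, D x ->
    {ae P, forall w, backward_iter (fun k => Phi k w) n x @[n --> \oo] --> Z w}.

End ifs.

Section tail_index.
Context {R : realType}.
Implicit Types (mu : set R -> \bar R) (theta : \bar R).
Local Open Scope ereal_scope.

(* [mu] is a law on [R]; [P(Y > x)] is [mu `]x, +oo[] *)
Definition log_tail_ratio mu (x : R) : \bar R :=
  lne (mu `]x, +oo[%classic) * ((ln x)^-1)%:E.

Definition is_lower_tail_index mu theta : Prop :=
  limf_esup (log_tail_ratio mu) +oo%R = - theta /\ - theta < 0.

Definition is_upper_tail_index mu theta : Prop :=
  limf_einf (log_tail_ratio mu) +oo%R = - theta /\ -oo < - theta.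

Definition is_tail_index mu (theta : R) : Prop :=
  [/\ (0 < theta)%R, is_lower_tail_index mu theta%:E &
      is_upper_tail_index mu theta%:E].

Definition scaled_tail mu (theta x : R) : \bar R :=
  (x `^ theta)%:E * mu `]x, +oo[%classic.

Definition is_exact_tail_index mu (theta : R) : Prop :=
  [/\ (0 < theta)%R, 0 < limf_einf (scaled_tail mu theta) +oo%R &
      limf_esup (scaled_tail mu theta) +oo%R < +oo].

End tail_index.

(* Main.v *)
Require Import Defs.
From HB Require Import structures.
From mathcomp Require Import all_boot all_order all_algebra finmap.
From mathcomp Require Import all_classical all_reals all_analysis.
From mathcomp Require Import measurable_realfun.

Set Implicit Arguments.
Unset Strict Implicit.
Unset Printing Implicit Defensive.

Import Order.TTheory GRing.Theory Num.Theory.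
Import numFieldNormedType.Exports.

Local Open Scope classical_set_scope.
Local Open Scope ring_scope.

(** A backward iterate has the same law as the corresponding forward iterate, so
    all backward iterates of the chain started from an independent point with
    law pi have law pi ([law_backward]), while pathwise they are sandwiched,
    after taking the distance to x0, between the backward iterates of F and G
    started from the distance of the starting point to x0, because F and G are
    nondecreasing on I. The outer members converge almost surely to the backward
    limits of F and G. Whenever the limit of F exceeds t, so does the distance
    for all large n, and Fatou's lemma gives the lower bound for the tail of the
    distance ([le_tail_eventually]); the upper bound is the same statement with
    reversed signs, up to the boundary of the half-line
    ([ge_tail_eventually]). If the chain itself has a backward limit, the limit
    is taken directly in the sandwich, started at x0.

    For the tail indices the laws of the backward limits have to be identified
    with the given stationary laws ([tail_backward_limit]). This is the same
    argument applied to F and to G alone: started from the stationary law,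
    every backward iterate has that law, and the iterates converge to the
    backward limit. The set I is
    arbitrary, possibly not Borel, so two points need care. The stationary law
    gives full mass to a Borel subset of I ([ae_stationary_domain]), and the
    random functions are replaced by jointly measurable ones that agree with
    them on I ([left_envelope]).

    The tails of the law of the distance thus lie between those of the two
    stationary laws, and the claims on tail indices follow by monotonicity of
    limits superior and inferior. *)

(** * Backward iterates of a stationary chain *)

(** The definition of the backward iterates peels off the innermost map; the
    recursion on laws needs the outermost one, which is applied last. *)
Lemma backward_iterSl (T : Type) (Phi : nat -> T -> T) n x :
  backward_iter Phi n.+1 x =
  Phi 0%N (backward_iter (fun j => Phi j.+1) n x).
Proof.
elim: n x => [//|n IHn] x.
exact: IHn.
Qed.

Section stationary_backward.
Local Open Scope ereal_scope.
Context {R : realType} {d} {Omega : measurableType d} (P : probability Omega R).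
Context {dA} {A : measurableType dA} {dT} {T : measurableType dT}.
Variables (theta : nat -> Omega -> A) (Psi : A -> T -> T).
Variable pi : probability T R.
Hypothesis theta_iid : iid P theta.
Hypothesis mPsi : measurable_fun setT (fun z : A * T => Psi z.1 z.2).
Hypothesis pi_stationary :
  stationary_law P setT (fun w => Psi (theta 0%N w)) pi.

Let mtheta k : measurable_fun setT (theta k).
Proof. by case: theta_iid. Qed.

Let W k n (z : T * Omega) :=
  backward_iter (fun j => Psi (theta (k + j)%N z.2)) n z.1.

Let WS k n z : W k n.+1 z = Psi (theta k z.2) (W k.+1 n z).
Proof.
rewrite /W backward_iterSl addn0.
by under [in LHS]eq_fun do rewrite -addSnnS.
Qed.

Let measurable_W k n : measurable_fun setT (W k n).
Proof.
elim: n k => [|n IHn] k; first exact: measurable_fst.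
rewrite (funext (WS k n)).
have mp : measurable_fun setT (fun z : T * Omega => (theta k z.2, W k.+1 n z)).
  by apply/measurable_fun_pair => //; exact: measurableT_comp.
exact: (measurableT_comp mPsi mp).
Qed.

HB.instance Definition _ :=
  isMeasurableFun.Build _ _ _ _ (theta 0%N) (mtheta 0%N).

(** Allowing Q to have a total mass different from 1 is what lets this be used
    after restriction to a conditioning event. *)
Let law_pair (m1 : {finite_measure set T -> \bar R})
    (m2 : {finite_measure set A -> \bar R})
    (Q : {measure set (T * Omega) -> \bar R})
    (f : T * Omega -> T) (g : T * Omega -> A) :
  measurable_fun setT f -> measurable_fun setT g ->
  (forall B C, measurable B -> measurable C ->
    Q (f @^-1` B `&` g @^-1` C) = m1 B * m2 C) ->
  forall D, measurable D ->
  Q [set z | D (f z, g z)] = (m1 \x m2) D.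
Proof.
move=> mf mg fgE D mD.
have mfg : measurable_fun setT (fun z => (f z, g z)).
  exact/measurable_fun_pair.
pose h : {mfun (T * Omega)%type >-> (T * A)%type} := mfun_Sub (mem_set mfg).
by rewrite (@product_measure_unique _ _ _ _ _ m1 m2 (pushforward Q h)).
Qed.

(** The iterate using the maps k, ..., k + n - 1 and an independent starting
    point with law pi again has law pi and is independent of the maps of index
    smaller than k. The independence is what makes the induction on n work:
    the iterate is obtained by applying map k to an iterate that only uses
    later maps, and hence is independent of map k; stationarity then gives the
    law of the result. *)
Lemma law_shifted_backward n k (J : {fset nat}) (S : nat -> set Omega)
    (B : set T) :
  (forall j, j \in J -> (j < k)%N /\ sigma_of (theta j) (S j)) ->
  measurable B ->
  (pi \x P) (W k n @^-1` B `&` [set z | (\bigcap_(j in [set` J]) S j) z.2]) =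
  pi B * P (\bigcap_(j in [set` J]) S j).
Proof.
have msigma j E : sigma_of (theta j) E -> measurable E.
  by move=> [C mC <-]; exact: mtheta.
have mJ (J' : {fset nat}) (S' : nat -> set Omega) :
    (forall j, j \in J' -> sigma_of (theta j) (S' j)) ->
    measurable (\bigcap_(j in [set` J']) S' j).
  move=> JS; apply: fin_bigcap_measurable => // j Jj.
  by apply: msigma (JS _ _).
elim: n k J S B => [|n IHn] k J S B JS mB.
  by rewrite -product_measure1E//; apply: mJ => j /JS[].
set E := \bigcap_(j in _) _.
have mE : measurable E by apply: mJ => j /JS[].
have PE0 : (0 <= fine (P E))%R by apply: fine_ge0.
(* Below, the pair formed by the later iterate and map k is seen, on the event
   E, to have law pi times m2. *)
pose m2 := mscale (NngNum PE0) (distribution P (theta 0%N)).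
have mD : measurable [set p : T * A | B (Psi p.2 p.1)].
  have msw : measurable_fun setT (fun p : T * A => (p.2, p.1)).
    by apply/measurable_fun_pair; [exact: measurable_snd|exact: measurable_fst].
  by rewrite -[X in measurable X]setTI; exact: (measurableT_comp mPsi msw).
have mE2 : measurable [set z : T * Omega | E z.2].
  by rewrite -[X in measurable X]setTI; apply: measurable_snd.
have -> : W k n.+1 @^-1` B `&` [set z | E z.2] =
    [set z | B (Psi (theta k z.2) (W k.+1 n z))] `&` [set z | E z.2].
  by apply/seteqP; split => z /= []; rewrite WS.
have -> : (pi \x P) ([set z | B (Psi (theta k z.2) (W k.+1 n z))] `&`
      [set z | E z.2]) = (pi \x m2) [set p : T * A | B (Psi p.2 p.1)].
  apply: (@law_pair pi m2 (mrestr (pi \x P) mE2) (W k.+1 n)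
    (fun z => theta k z.2) _ _ _ _ mD) => //; first exact: measurableT_comp.
  move=> B' C mB' mC.
  (* The event that theta k falls in C joins the conditioning event, so that
     the induction hypothesis applies to the iterate built from the maps of
     index larger than k. *)
  pose S' j := if j == k then theta k @^-1` C else S j.
  have JS' j : j \in (k |` J)%fset -> (j < k.+1)%N /\ sigma_of (theta j) (S' j).
    rewrite !inE /S'; have [-> _|jk /= /JS[jltk Sj]] := eqVneq j k.
      by split => //; exists C => //; rewrite setTI.
    by split => //; exact: ltnW.
  have kJ : k \notin J by apply/negP => /JS[]; rewrite ltnn.
  have E' : \bigcap_(j in [set` (k |` J)%fset]) S' j = theta k @^-1` C `&` E.
    apply/seteqP; split => w.
      move=> Sw; split.
        by have := Sw k; rewrite /S' eqxx; apply; rewrite /= !inE eqxx.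
      move=> j /= Jj; have := Sw j; rewrite /S'; case: eqVneq => [jk|_]; last first.
        by apply; rewrite /= !inE Jj orbT.
      by move: kJ; rewrite -jk Jj.
    move=> [Cw Ew] j /=; rewrite !inE /S'; case: eqVneq => //= _ Jj.
    exact: Ew.
  have := IHn k.+1 _ S' _ JS' mB'; rewrite E'.
  have -> : W k.+1 n @^-1` B' `&` [set z | (theta k @^-1` C `&` E) z.2] =
    W k.+1 n @^-1` B' `&` (fun z => theta k z.2) @^-1` C `&` [set z | E z.2].
    by apply/seteqP; split => z /=; tauto.
  move=> IH; apply: (etrans IH); congr (_ * _).
  rewrite -E'.
  have [_ same indep] := theta_iid.
  rewrite indep; last by move=> j /JS'[].
  rewrite (big_fsetD1 k) /=; last by rewrite !inE eqxx.
  rewrite fsetU1K// {1}/S' eqxx same// muleC /mscale/= fineK ?fin_num_measure//.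
  rewrite /E indep; last by move=> j /JS[].
  congr (_ * _); apply: eq_big_seq => j Jj; rewrite /S'; case: eqVneq => // jk.
  by move: kJ; rewrite -jk Jj.
have -> : (pi \x m2) [set p | B (Psi p.2 p.1)] =
    P E * (pi \x P) [set z | setT z.1 /\ B (Psi (theta 0%N z.2) z.1)].
  pose D := [set p : T * A | B (Psi p.2 p.1)].
  transitivity (\int[pi]_x (P E * distribution P (theta 0%N) (xsection D x))).
    apply: eq_integral => x _.
    by rewrite /m2 /mscale /= fineK// fin_num_measure.
  rewrite ge0_integralZl//; last exact: measurable_fun_xsection.
  congr (_ * _); apply: eq_integral => x _; rewrite /distribution /pushforward /=.
  by congr (P _); apply/seteqP; split => w; rewrite /xsection /= !inE //= => -[].
by rewrite pi_stationary// muleC.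
Qed.

Lemma measurable_backward n : measurable_fun setT
  (fun z : T * Omega => backward_iter (fun j => Psi (theta j z.2)) n z.1).
Proof. exact: (measurable_W 0%N n). Qed.

Lemma law_backward n (B : set T) : measurable B ->
  (pi \x P) [set z | B (backward_iter (fun j => Psi (theta j z.2)) n z.1)] =
  pi B.
Proof.
move=> mB; have := @law_shifted_backward n 0%N fset0 (fun=> setT) B.
rewrite set_fset0 bigcap_set0 probability_setT mule1 => <- //.
by apply: (congr1 (pi \x P)); apply/seteqP; split => // z [].
Qed.

End stationary_backward.

(** * Comparison of tails through eventual inequalities *)

Lemma ae_le_measure d (T : measurableType d) (R : realType)
    (mu : {measure set T -> \bar R}) (A B : set T) :
  measurable A -> measurable B -> (\forall x \ae mu, A x -> B x) ->
  (mu A <= mu B)%E.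
Proof.
move=> mA mB [N [mN N0 AN]]; rewrite -[leRHS]adde0 -N0.
apply: (le_trans _ (measureU2 mu mB mN)); apply: le_measure; rewrite ?inE//.
  exact: measurableU.
move=> x Ax; have [Bx|nBx] := pselect (B x); [by left|right].
by apply: AN => /= /(_ Ax).
Qed.

Section superlevel_sets.
Context {R : realType} {d} {S : measurableType d} (g : S -> R) (t : R).
Hypothesis mg : measurable_fun setT g.

Lemma measurable_gt_set : measurable [set x | t < g x].
Proof.
rewrite -[X in measurable X]setTI -preimage_itvoy.
by apply: mg => //; exact: measurable_itv.
Qed.

Lemma measurable_ge_set : measurable [set x | t <= g x].
Proof.
rewrite -[X in measurable X]setTI -preimage_itvcy.
by apply: mg => //; exact: measurable_itv.
Qed.

End superlevel_sets.

(** The maps V n stand for backward iterates on the product space, each of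
    which has law pi when its starting point does. If V n eventually passes
    every test that Y passes, then Fatou's lemma bounds the law of Y by pi. *)
Section tail_comparison.
Local Open Scope ereal_scope.
Context {R : realType} {d} {Omega : measurableType d} (P : probability Omega R).
Context {dT} {T : measurableType dT} (pi : probability T R).
Variable V : nat -> T * Omega -> T.
Hypothesis mV : forall n, measurable_fun setT (V n).
Hypothesis V_law : forall n B, measurable B ->
  (pi \x P) [set z | B (V n z)] = pi B.

Lemma le_tail_eventually (Y : Omega -> R) (f : T -> R) (t : R) :
  measurable_fun setT Y -> measurable_fun setT f ->
  (\forall x \ae pi, \forall w \ae P,
     (t < Y w)%R -> \forall n \near \oo, (t < f (V n (x, w)))%R) ->
  P [set w | (t < Y w)%R] <= pi [set x | (t < f x)%R].
Proof.
move=> mY mf Yf.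
have mtf : measurable [set x | (t < f x)%R].
  exact: measurable_gt_set.
have mtY : measurable [set w | (t < Y w)%R].
  exact: measurable_gt_set.
have mtV n : measurable [set z | (t < f (V n z))%R].
  by have := mV n measurableT mtf; rewrite setTI.
pose L m := \bigcap_(n in [set n | (m <= n)%N]) [set z | (t < f (V n z))%R].
have mL m : measurable (L m) by apply: bigcap_measurableType.
have mUL : measurable (\bigcup_m L m) by exact: bigcupT_measurable.
have ndL : nondecreasing_seq L.
  move=> m p mp; apply/subsetPset => z Lz n /= pn.
  exact: (Lz n (leq_trans mp pn)).
have UL_le : (pi \x P) (\bigcup_m L m) <= pi [set x | (t < f x)%R].
  have cv := nondecreasing_cvg_mu (mu := pi \x P) mL mUL ndL.
  rewrite -(cvg_lim _ cv)//; apply: lime_le; first exact: cvgP cv.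
  apply: nearW => m /=; rewrite -(V_law m mtf); apply: le_measure; rewrite ?inE//.
    exact: mtV.
  by move=> z Lz; exact: (Lz m (leqnn m)).
apply: le_trans UL_le.
rewrite /product_measure1 -[leLHS]mule1 -(probability_setT pi) -integral_cst//.
apply: ae_ge0_le_integral => //; first exact: measurable_fun_xsection.
apply: filterS Yf => x Yfx _ /=.
apply: ae_le_measure => //; first exact: measurable_xsection.
apply: filterS Yfx => w + tY; move=> /(_ tY)[m _ mf_].
by rewrite /xsection /= inE; exists m.
Qed.

(** Applied to -Y and -f, the previous lemma compares the open left half-lines,
    and hence, by complementation, the closed right ones. Open right half-lines
    are increasing unions of closed ones. *)
Lemma ge_tail_eventually (Y : Omega -> R) (f : T -> R) (t : R) :
  measurable_fun setT Y -> measurable_fun setT f ->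
  (forall s : R, \forall x \ae pi, \forall w \ae P,
     (Y w < s)%R -> \forall n \near \oo, (f (V n (x, w)) < s)%R) ->
  pi [set x | (t < f x)%R] <= P [set w | (t < Y w)%R].
Proof.
move=> mY mf Yf.
have closed_tail s : pi [set x | (s <= f x)%R] <= P [set w | (s <= Y w)%R].
  have setC_lt S (g : S -> R) :
      [set x | (s <= g x)%R] = ~` [set x | (- s < - g x)%R].
    by apply/seteqP; split => x /=; rewrite ltrN2 leNgt => /negP.
  rewrite !setC_lt !probability_setC; [|exact/measurable_gt_set/measurable_funN..].
  rewrite leeB//.
  apply: (@le_tail_eventually (fun w => - Y w)%R (fun x => - f x)%R).
  - exact: measurable_funN.
  - exact: measurable_funN.
  - apply: filterS (Yf s) => x; apply: filterS => w.
    by rewrite ltrN2 => Ys /Ys; apply: filterS => n; rewrite ltrN2.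
pose C (m : nat) := [set x | (t + m.+1%:R^-1 <= f x)%R].
have UC : [set x | (t < f x)%R] = \bigcup_m C m.
  apply/seteqP; split => [x /= tf|x [m _]]; last first.
    by apply: lt_le_trans; rewrite ltrDl invr_gt0.
  have := tf; rewrite -subr_gt0 => /ltr_add_invr[m]; rewrite add0r => mlt.
  by exists m => //; rewrite /C /= -lerBrDl ltW.
have mC m : measurable (C m) by exact: measurable_ge_set.
have ndC : nondecreasing_seq C.
  move=> m n mn; apply/subsetPset => x; apply: le_trans.
  by rewrite lerD2l lef_pV2 ?posrE// ler_nat ltnS.
have cv := nondecreasing_cvg_mu (mu := pi) mC (bigcupT_measurable C mC) ndC.
rewrite UC -(cvg_lim _ cv)//; apply: lime_le; first exact: cvgP cv.
apply: nearW => m /=; apply: le_trans (closed_tail _) _.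
apply: le_measure; rewrite ?inE; [exact: measurable_ge_set|exact: measurable_gt_set|].
by move=> w /=; apply: lt_le_trans; rewrite ltrDl invr_gt0.
Qed.

End tail_comparison.

(** * Jointly measurable versions of monotone random functions *)

(** The points of I that can be approached from the left within I are handled by
    picking a point of I in each rational interval. Any other point is the least
    element of I above some rational, so there are countably many of them, and
    they are included in the family. *)
Lemma left_dense_family (R : realType) (I : set R) : I !=set0 ->
  exists q : (rat * rat) + rat -> R, (forall k, I (q k)) /\
    forall x e, I x -> 0 < e -> exists k, x - e < q k <= x.
Proof.
move=> [y0 Iy0].
pose A (k : (rat * rat) + rat) : set R := match k with
  | inl p => [set y | I y /\ ratr p.1 < y < ratr p.2]
  | inr r =>
    [set y | [/\ I y, ratr r < y & forall z, I z -> ratr r < z -> y <= z]]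
  end.
have AI k y : A k y -> I y by case: k => [p|r] [].
exists (fun k => xget y0 (A k)); split.
  by move=> k; case: xgetP => // y _ /AI.
move=> x e Ix e0.
have /rat_in_itvoo[r] : x - e < x by rewrite ltrBlDr ltrDl.
rewrite in_itv /= => /andP[xer rx].
have [[y [Iy ry yx]]|noy] := pselect (exists y, [/\ I y, ratr r < y & y < x]).
  have [s] := rat_in_itvoo yx; rewrite in_itv /= => /andP[ys sx].
  exists (inl (r, s)); case: xgetP => [z _ [_ /andP[/= rz zs]]|/(_ y) []].
    by rewrite (lt_trans xer rz) ltW// (lt_trans zs).
  by rewrite /A /= ry ys.
exists (inr r); case: xgetP => [z _ [Iz rz zmin]|/(_ x) []].
  by rewrite (lt_trans xer rz) zmin.
split => // z Iz rz; rewrite leNgt; apply/negP => zx.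
by apply: noy; exists z.
Qed.

(** A random function that is only controlled on I, a set that need not be
    Borel, need not be jointly measurable in the function and its argument.
    Taking the supremum of its values at those points of a countable family
    that lie to the left of the argument gives a jointly measurable map, which
    agrees with the function on I when the latter is nondecreasing and
    continuous there. *)
Section left_envelope.
Context {R : realType} {K : Type} (q : K -> R).

Definition left_envelope (f : R -> R) (x : R) : R :=
  fine (ereal_sup [set (f (q k))%:E | k in [set k | q k <= x]]).

Lemma left_envelopeE (I : set R) (f : R -> R) (x : R) :
  (forall k, I (q k)) ->
  (forall x e, I x -> 0 < e -> exists k, x - e < q k <= x) ->
  (forall s t, I s -> I t -> s <= t -> f s <= f t) ->
  {within I, continuous f} -> I x -> left_envelope f x = f x.
Proof.
move=> Iq qdense fnd fc Ix; rewrite /left_envelope.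
suff -> : ereal_sup [set (f (q k))%:E | k in [set k | q k <= x]] = (f x)%:E.
  by [].
apply/eqP; rewrite eq_le; apply/andP; split.
  by apply: ge_ereal_sup => _ [k /= qx <-]; rewrite lee_fin; exact: fnd.
apply/lee_addgt0Pr => e e0.
move/subspace_continuousP : fc => /(_ x Ix) /cvgrPdist_lt /(_ e e0).
rewrite near_withinE => /nbhs_ballP[dl /= dl0 fdl].
have [k /andP[xq qx]] := qdense x dl Ix dl0.
have := fdl (q k); rewrite /ball /= => /(_ _ (Iq k)).
rewrite ger0_norm ?subr_ge0// ltrBlDr addrC -ltrBlDr => /(_ xq) fxq.
apply: (@le_trans _ _ ((f (q k))%:E + e%:E)%E); last first.
  by rewrite leeD2r//; apply: ereal_sup_ubound; exists k.
rewrite -EFinD lee_fin -lerBlDr.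
by rewrite lerBlDl addrC -lerBlDl; apply: le_trans (ler_norm _) (ltW fxq).
Qed.

Lemma measurable_left_envelope (I : set R) :
  countable [set: K] -> (forall k, I (q k)) ->
  measurable_fun setT
    (fun z : random_map_space I R * R => left_envelope z.1 z.2).
Proof.
move=> cK Iq.
have meval k : measurable_fun setT
    (fun z : random_map_space I R * R => (z.1 : R -> R) (q k)).
  apply: (@measurableT_comp _ _ _ _ _ _
    (fun f : random_map_space I R => (f : R -> R) (q k)) _ fst) => //.
  move=> _ B mB; rewrite setTI; apply: sub_sigma_algebra.
  by exists (q k) => //; exists B; rewrite ?setTI.
apply: measurableT_comp => //.
move=> _; apply: (measurability _ (ErealGenOInfty.measurableE R)) => //.
move=> /= _ [_ [a ->]] <-; rewrite setTI.
rewrite (_ : _ @^-1` _ = \bigcup_k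
  ([set z : random_map_space I R * R | q k <= z.2] `&`
   [set z : random_map_space I R * R | a < (z.1 : R -> R) (q k)])).
  apply: countable_bigcupT_measurable => // k; apply: measurableI.
    rewrite -[X in measurable X]setTI -preimage_itvcy.
    by apply: measurable_snd => //; exact: measurable_itv.
  rewrite -[X in measurable X]setTI -preimage_itvoy.
  by apply: meval => //; exact: measurable_itv.
apply/seteqP; split => [z /=|z [k _ /= [qz aq]]]; rewrite /= in_itv /= andbT.
  by case/ereal_sup_gt => _ [k /= qz <-]; rewrite lte_fin => aq; exists k.
apply: (@lt_le_trans _ _ (((z.1 : R -> R) (q k))%:E)); first by rewrite lte_fin.
by apply: ereal_sup_ubound; exists k.
Qed.

End left_envelope.

(** * Integrals of functions that need not be measurable *)

(** Since I need not be measurable, the stationarity equation evaluates the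
    product measure at sets for which the probability of the section need not
    be a measurable function of the starting point. The integral of a nonnegative function being defined as a
    supremum over simple functions, it remains monotone on such integrands. *)
Section nonmeasurable_integrands.
Local Open Scope ereal_scope.
Context d (T : measurableType d) (R : realType) (pi : probability T R).

Import HBNNSimple.

Lemma ge0_le_integral_nonmeasurable (f g : T -> \bar R) :
  (forall x, 0 <= f x) -> (forall x, f x <= g x) ->
  \int[pi]_x f x <= \int[pi]_x g x.
Proof.
move=> f0 fg; rewrite !ge0_integralTE//; last by move=> x; exact: le_trans (fg x).
apply: le_ereal_sup => _ [h hf <-]; exists h => // x.
exact: le_trans (fg x).
Qed.

Lemma ae_ge0_le_integral_nonmeasurable (f g : T -> \bar R) :
  measurable_fun setT f -> (forall x, 0 <= f x) -> (forall x, 0 <= g x) ->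
  (\forall x \ae pi, f x <= g x) ->
  \int[pi]_x f x <= \int[pi]_x g x.
Proof.
move=> mf f0 g0 [N [mN N0 fgN]].
rewrite (ge0_negligible_integral mN)// integral_mkcond setTD.
apply: ge0_le_integral_nonmeasurable => x; rewrite /patch; case: ifPn => //.
by move/set_mem => Nx; apply: contrapT => fg; apply: Nx; apply: fgN.
Qed.

(** The integral is the inner measure of D. The supports of simple functions
    below the indicator of D whose integrals are close to 1 are measurable
    subsets of D that exhaust the mass of pi. *)
Lemma ae_of_integral_indic (D : set T) :
  \int[pi]_x (\1_D x)%:E = 1 -> \forall x \ae pi, D x.
Proof.
move=> D1.
have D0 x : 0 <= (\1_D x)%:E :> \bar R by rewrite lee_fin.
have approx (n : nat) : exists S,
    [/\ measurable S, S `<=` D & 1 - (n.+1%:R^-1)%:E <= pi S].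
  have : 1 - (n.+1%:R^-1)%:E < \int[pi]_x (\1_D x)%:E.
    by rewrite D1 -EFinB lte_fin ltrBlDr ltrDl invr_gt0.
  rewrite ge0_integralTE// => /ereal_sup_gt[_ [h /= hD <-] hn].
  have mS : measurable [set x | (0 < h x)%R].
    by rewrite -preimage_itvoy; exact: measurable_funPTI.
  exists [set x | (0 < h x)%R]; split => //.
    move=> x /= hx; have := hD x; rewrite lee_fin indicE.
    by case: (boolP (x \in D)) => [/set_mem//|_]; rewrite leNgt hx.
  apply: (le_trans (ltW hn)); rewrite -integralT_nnsfun.
  rewrite -[X in pi X]setIT -integral_indic//.
  apply: ge0_le_integral_nonmeasurable => x; first by rewrite lee_fin fun_ge0.
  rewrite indicE; case: (boolP (x \in _)) => [_|/negP xS].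
    apply: le_trans (hD x) _; rewrite lee_fin indicE.
    by case: (x \in D).
  by rewrite lee_fin leNgt; apply/negP => hx; apply: xS; rewrite inE.
have /choice[S PS] := approx.
have mS n : measurable (S n) by have [] := PS n.
have mU : measurable (\bigcup_n S n) by exact: bigcupT_measurable.
exists (~` \bigcup_n S n); split; first exact: measurableC.
  rewrite probability_setC//; suff -> : pi (\bigcup_n S n) = 1 by rewrite subee.
  apply/eqP; rewrite eq_le probability_le1//=.
  apply/lee_addgt0Pr => e e0.
  have := e0 => /ltr_add_invr[n]; rewrite add0r => ne.
  have [_ _ Sn] := PS n.
  rewrite -leeBlDr//; apply: (@le_trans _ _ (1 - (n.+1%:R^-1)%:E)).
    by rewrite -!EFinB lee_fin lerB// ltW.
  by apply: le_trans Sn _; apply: le_measure; rewrite ?inE//; exact: bigcup_sup.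
apply: subsetC => x [n _]; have [_ + _] := PS n; exact.
Qed.

End nonmeasurable_integrands.

(** * The stationary law is the law of the backward limit *)

(** The random maps F are read off from an iid sequence a of richer data through
    phi, so that independence can be used for a without being transferred to
    each coordinate. *)
Section law_of_backward_limit.
Local Open Scope ereal_scope.
Context {R : realType} {d} {Omega : measurableType d} (P : probability Omega R).
Context {dA} {A : measurableType dA} (a : nat -> Omega -> A).
Variables (I : set R) (phi : A -> random_map_space I R).
Hypothesis a_iid : iid P a.
Hypothesis mphi : measurable_fun setT phi.
Let F n w : R -> R := phi (a n w).
Hypothesis F_stable : forall n w t, I t -> I (F n w t).
Hypothesis F_nondecreasing :
  forall n w s t, I s -> I t -> (s <= t)%R -> (F n w s <= F n w t)%R.
Hypothesis F_continuous : forall n w, {within I, continuous (F n w)}.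
Variable piF : probability R R.
Hypothesis piF_stationary : stationary_law P I (F 0%N) piF.

(** Stationarity tested on the whole line says that the integral of the
    indicator of I is 1. *)
Lemma ae_stationary_domain : \forall x \ae piF, I x.
Proof.
apply: ae_of_integral_indic.
rewrite -(probability_setT piF) -piF_stationary//.
apply: eq_integral => x _; rewrite indicE /=.
case: (boolP (x \in I)) => xI.
  rewrite -(probability_setT P); congr (P _); apply/seteqP; split => // w _.
  by rewrite /xsection /= inE /=; split => //; exact: set_mem.
transitivity (P set0); first by rewrite measure0.
congr (P _); apply/seteqP; split => // w.
by rewrite /xsection /= inE => -[/= /mem_set]; rewrite (negbTE xI).
Qed.

(** Started from an independent point with law piF, each backward iterate has
    law piF, and for almost every starting point it converges almost surely
    to Y. Thus existence of a stationary law is enough to identify it as the law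
    of Y. *)
Lemma tail_backward_limit (Y : Omega -> R) (t : R) : measurable_fun setT Y ->
  backward_limit P I F Y ->
  P [set w | (t < Y w)%R] = piF [set x | (t < x)%R].
Proof.
move=> mY limY.
have [x0 Ix0] : I !=set0.
  apply/set0P/eqP => I0.
  have [N [mN N0 NI]] := ae_stationary_domain.
  have NT : N = setT.
    by apply/seteqP; split => // x _; apply: NI; rewrite /= I0.
  by have := probability_setT piF; rewrite -NT N0 => /eqP; rewrite lt_eqF.
have [|q [Iq qdense]] := @left_dense_family R I; first by exists x0.
have cK : countable [set: (rat * rat) + rat] by exact: countableP.
pose Psi s x := left_envelope q (phi s) x.
have PsiE n w x : I x -> Psi (a n w) x = F n w x.
  by move=> Ix; apply: (@left_envelopeE _ _ q I) => //;
    [exact: F_nondecreasing|exact: F_continuous].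
have mPsi : measurable_fun setT (fun z : A * R => Psi z.1 z.2).
  have mp : measurable_fun setT
      (fun z : A * R => (phi z.1, z.2) : random_map_space I R * R).
    by apply/measurable_fun_pair => //; exact: measurableT_comp.
  exact: (measurableT_comp (@measurable_left_envelope _ _ q I cK Iq) mp).
(* The two sides are integrals of functions of the starting point that agree on
   I; off I, the one for F vanishes. *)
have Psi_stationary : stationary_law P setT (fun w => Psi (a 0%N w)) piF.
  move=> B mB.
  have mD : measurable [set z : R * Omega | B (Psi (a 0%N z.2) z.1)].
    have mp : measurable_fun setT (fun z : R * Omega => (a 0%N z.2, z.1)).
      apply/measurable_fun_pair => //.
      by apply: measurableT_comp => //; case: a_iid.
    by rewrite -[X in measurable X]setTI; exact: (measurableT_comp mPsi mp).
  rewrite (_ : [set z | _] = [set z : R * Omega | B (Psi (a 0%N z.2) z.1)]);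
    last by apply/seteqP; split => z // -[].
  have sectionE x : I x ->
      xsection [set z : R * Omega | B (Psi (a 0%N z.2) z.1)] x =
      xsection [set z | I z.1 /\ B (F 0%N z.2 z.1)] x.
    move=> Ix; apply/seteqP; split => w; rewrite /xsection /= !inE /= PsiE//.
    by case.
  apply/eqP; rewrite -[X in _ == X](piF_stationary mB) eq_le; apply/andP; split.
    apply: ae_ge0_le_integral_nonmeasurable => //.
      exact: measurable_fun_xsection.
    by apply: filterS ae_stationary_domain => x Ix /=; rewrite sectionE.
  apply: ge0_le_integral_nonmeasurable => // x /=.
  have [Ix|nIx] := pselect (I x); first by rewrite sectionE.
  rewrite (_ : xsection _ _ = set0) ?measure0//.
  by apply/seteqP; split => // w; rewrite /xsection /= inE => -[].
have backE n w x : I x ->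
    backward_iter (fun j => Psi (a j w)) n x = backward_iter (F^~ w) n x.
  elim: n x => [//|n IHn] x Ix; rewrite /= PsiE// IHn//; exact: F_stable.
pose V n (z : R * Omega) := backward_iter (fun j => Psi (a j z.2)) n z.1.
have mV n : measurable_fun setT (V n) by exact: (measurable_backward a_iid mPsi).
have V_law n B : measurable B -> (piF \x P) [set z | B (V n z)] = piF B.
  by move=> mB; exact: (law_backward a_iid mPsi Psi_stationary).
have mid : measurable_fun setT (fun x : R => x) by exact: measurable_id.
apply/eqP; rewrite eq_le; apply/andP; split.
  apply: (le_tail_eventually mV V_law mY mid).
  apply: filterS ae_stationary_domain => x Ix.
  apply: filterS (limY x Ix) => w /cvgr_gt/[apply]; apply: filterS => n.
  by rewrite /V /= backE.
apply: (ge_tail_eventually mV V_law t mY mid) => s.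
apply: filterS ae_stationary_domain => x Ix.
apply: filterS (limY x Ix) => w /cvgr_lt/[apply]; apply: filterS => n.
by rewrite /V /= backE.
Qed.

End law_of_backward_limit.

(** * Tail indices of ordered tails *)

Section tail_monotonicity.
Local Open Scope ereal_scope.
Context {R : realType}.

Lemma le_limf_esup (F : set_system R) (f g : R -> \bar R) : Filter F ->
  (\forall x \near F, f x <= g x) -> limf_esup f F <= limf_esup g F.
Proof.
move=> FF fg; rewrite !limf_esupE; apply: le_ereal_inf_tmp => _ [V FV <-].
pose W := V `&` [set x | f x <= g x].
apply: (@le_trans _ _ (ereal_sup (f @` W))).
  by apply: ereal_inf_lbound; exists W => //; exact: filterI.
apply: ge_ereal_sup => _ [x [Vx fgx] <-]; apply: le_trans fgx _.
by apply: ereal_sup_ubound; exists x.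
Qed.

Lemma le_limf_einf (F : set_system R) (f g : R -> \bar R) : Filter F ->
  (\forall x \near F, f x <= g x) -> limf_einf f F <= limf_einf g F.
Proof.
move=> FF fg; rewrite /limf_einf leeN2; apply: le_limf_esup.
by apply: filterS fg => x; rewrite leeN2.
Qed.

Lemma limf_einf_le_esup (F : set_system R) (f : R -> \bar R) : ProperFilter F ->
  limf_einf f F <= limf_esup f F.
Proof.
move=> FF; rewrite limf_einfE limf_esupE.
apply: ge_ereal_sup => _ [V FV <-]; apply: le_ereal_inf_tmp => _ [W FW <-].
have /filter_ex[x [Vx Wx]] : F (V `&` W) by exact: filterI.
apply: (@le_trans _ _ (f x)).
  by apply: ereal_inf_lbound; exists x.
by apply: ereal_sup_ubound; exists x.
Qed.

Implicit Types mu nu : set R -> \bar R.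

(** The lower bound 0 is included because the tail indices are defined for
    arbitrary set functions, and the logarithm is monotone on nonnegative
    arguments. *)
Definition tail_dominated mu nu := forall x : R, (0 <= x)%R ->
  0 <= mu `]x, +oo[%classic <= nu `]x, +oo[%classic.

Lemma le_log_tail_ratio mu nu : tail_dominated mu nu ->
  \forall x \near +oo%R, log_tail_ratio mu x <= log_tail_ratio nu x.
Proof.
move=> munu; near=> x.
have x1 : (1 < x)%R by near: x; exact: nbhs_pinfty_gt.
have /andP[mu0 mule] := munu x (ltW (lt_trans ltr01 x1)).
apply: lee_wpmul2r; first by rewrite lee_fin invr_ge0 ln_ge0 ?ltW.
by rewrite lee_lne// in_itv /= leey andbT// (le_trans mu0).
Unshelve. all: by end_near. Qed.

Lemma le_scaled_tail mu nu theta : tail_dominated mu nu ->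
  \forall x \near +oo%R, scaled_tail mu theta x <= scaled_tail nu theta x.
Proof.
move=> munu; near=> x.
have x0 : (0 < x)%R by near: x; exact: nbhs_pinfty_gt.
have /andP[mu0 mule] := munu x (ltW x0).
by apply: lee_wpmul2l => //; rewrite lee_fin powR_ge0.
Unshelve. all: by end_near. Qed.

(** Larger tails have larger logarithmic tail ratios, and the indices are the
    opposites of the limits superior and inferior of these ratios. *)
Lemma tail_indices_between mu nu1 nu2 theta1 theta2 :
  tail_dominated nu1 mu -> tail_dominated mu nu2 ->
  is_tail_index nu1 theta1 -> is_tail_index nu2 theta2 ->
  exists theta_low theta_up : \bar R,
    [/\ is_lower_tail_index mu theta_low, is_upper_tail_index mu theta_up &
        [/\ theta2%:E <= theta_low, theta_low <= theta_up &
            theta_up <= theta1%:E]].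
Proof.
move=> nu1mu munu2 [_ _ [up1 _]] [theta20 [low2 _] _].
pose ls := limf_esup (log_tail_ratio mu) +oo%R.
pose li := limf_einf (log_tail_ratio mu) +oo%R.
have lsle : ls <= - theta2%:E.
  by rewrite -low2; exact/le_limf_esup/le_log_tail_ratio.
have lile : - theta1%:E <= li.
  by rewrite -up1; exact/le_limf_einf/le_log_tail_ratio.
exists (- ls), (- li); split.
- split; first by rewrite oppeK.
  by rewrite oppeK (le_lt_trans lsle)// lteNl oppe0 lte_fin.
- by split; rewrite oppeK// (lt_le_trans _ lile)// ltNye.
- split; [by rewrite leeNr| |by rewrite leeNl].
  by rewrite leeN2; exact: limf_einf_le_esup.
Qed.

Lemma exact_tail_index_between mu nu1 nu2 theta :
  tail_dominated nu1 mu -> tail_dominated mu nu2 ->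
  is_exact_tail_index nu1 theta -> is_exact_tail_index nu2 theta ->
  is_exact_tail_index mu theta.
Proof.
move=> nu1mu munu2 [theta0 inf1 _] [_ _ sup2]; split => //.
  by apply: lt_le_trans inf1 _; exact/le_limf_einf/le_scaled_tail.
by apply: le_lt_trans sup2; exact/le_limf_esup/le_scaled_tail.
Qed.

End tail_monotonicity.

(** * Pathwise comparison of the iterations *)

Section comparison_of_iterations.
Context {R : realType} {X : metricType R} (x0 : X) (I : set R).
Hypothesis I_nonneg : `[0, +oo[ `<=` I.

Lemma mdist_in x : I (mdist x0 x).
Proof. by apply: I_nonneg; rewrite /= in_itv /= andbT mdist_ge0. Qed.

Variables (F : nat -> R -> R).
Hypothesis F_stable : forall n t, I t -> I (F n t).
Hypothesis F_nondecreasing :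
  forall n s t, I s -> I t -> s <= t -> F n s <= F n t.

Lemma backward_iter_nondecreasing n s t :
  I s -> I t -> s <= t -> backward_iter F n s <= backward_iter F n t.
Proof.
elim: n s t => //= n IHn s t Is It st.
by apply: IHn; [exact: F_stable..|exact: F_nondecreasing].
Qed.

(** The monotonicity of the outer iterates propagates the one-step bound for
    the innermost map. *)
Lemma backward_iter_le_mdist (Psi : nat -> X -> X) :
  (forall n x, F n (mdist x0 x) <= mdist x0 (Psi n x)) ->
  forall n x,
    backward_iter F n (mdist x0 x) <= mdist x0 (backward_iter Psi n x).
Proof.
move=> FPsi; elim=> [//|n IHn] x /=; apply: le_trans (IHn _).
by apply: backward_iter_nondecreasing; [exact/F_stable/mdist_in|exact: mdist_in|].
Qed.

Lemma mdist_le_backward_iter (Psi : nat -> X -> X) :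
  (forall n x, mdist x0 (Psi n x) <= F n (mdist x0 x)) ->
  forall n x,
    mdist x0 (backward_iter Psi n x) <= backward_iter F n (mdist x0 x).
Proof.
move=> FPsi; elim=> [//|n IHn] x /=; apply: le_trans (IHn _) _.
by apply: backward_iter_nondecreasing; [exact: mdist_in|exact/F_stable/mdist_in|].
Qed.

End comparison_of_iterations.

Lemma continuous_mdist (R : realType) (X : metricType R) (x0 : X) :
  continuous (mdist x0 : X -> R).
Proof.
move=> y; apply/cvgrPdist_lt => e e0; apply/nbhs_ballP; exists e => //= z.
rewrite ballEmdist /= => yz; apply: le_lt_trans yz.
rewrite ler_norml; apply/andP; split.
  by rewrite lerNl opprB lerBlDl; exact: metric_triangle.
by rewrite lerBlDl (metric_sym y z); exact: metric_triangle.
Qed.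

Lemma measurable_mdist (R : realType) (X : completeMetricType R) (x0 : X) :
  measurable_fun setT (mdist x0 : borel X -> R).
Proof.
move=> _; apply: (measurability _ (RGenOpens.measurableE R)) => //.
move=> /= _ [_ [a [b ->]] <-]; rewrite setTI; apply: sub_sigma_algebra.
by apply: open_comp => // y _; exact: continuous_mdist.
Qed.

(** * The comparison theorem *)

Theorem theorem5p1 (R : realType)
  (X : completeMetricType R)
  (X_separable : separable X)
  (X_unbounded : unbounded_metric X)
  (d : measure_display) (Omega : measurableType d) (P : probability Omega R)
  (* the IFS of iid Lipschitz maps; indices start at 0 instead of 1 *)
  (dTheta : measure_display) (Theta : measurableType dTheta)
  (theta : nat -> Omega -> Theta)
  (Psi : Theta -> X -> X)
  (X0 : Omega -> X)
  (X0_measurable : measurable_fun setT (X0 : Omega -> borel X))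
  (theta_iid : iid P theta)
  (theta_X0 : seq_independent_of P theta (X0 : Omega -> borel X))
  (Psi_measurable : measurable_fun setT
     (fun z : Theta * borel X => Psi z.1 z.2 : borel X))
  (Psi_lipschitz : forall a : Theta, is_lipschitz (Psi a))
  (pi : probability (borel X) R)
  (pi_stationary : stationary_law P (setT : set (borel X))
     (fun w => Psi (theta 0%N w)) pi)
  (X0_law : forall B : set (borel X), measurable B -> P (X0 @^-1` B) = pi B)
  (x0 : X)
  (* the random functions F_n, G_n : I -> I *)
  (I : set R) (I_nonneg : `[0, +oo[ `<=` I)
  (F G : nat -> Omega -> R -> R)
  (F_stable : forall n w t, I t -> I (F n w t))
  (G_stable : forall n w t, I t -> I (G n w t))
  (F_nondecreasing : forall n w s t, I s -> I t -> s <= t -> F n w s <= F n w t)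
  (G_nondecreasing : forall n w s t, I s -> I t -> s <= t -> G n w s <= G n w t)
  (F_continuous : forall n w, {within I, continuous (F n w)})
  (G_continuous : forall n w, {within I, continuous (G n w)})
  (C1_iid : iid P (fun n w =>
     (Psi (theta n w), F n w, G n w) :
       random_map_space (setT : set X) (borel X) *
       random_map_space I R * random_map_space I R))
  (C1_X0 : seq_independent_of P (fun n w =>
     (Psi (theta n w), F n w, G n w) :
       random_map_space (setT : set X) (borel X) *
       random_map_space I R * random_map_space I R)
     (X0 : Omega -> borel X))
  (C2 : {ae P, forall w, forall (x : X) (n : nat),
     F n w (mdist x0 x) <= mdist x0 (Psi (theta n w) x) <= G n w (mdist x0 x)})
  (F_contractive : contractive P (fun s t : R => `|s - t|) I F)
  (G_contractive : contractive P (fun s t : R => `|s - t|) I G)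
  (Yhat Zhat : Omega -> R)
  (Yhat_measurable : measurable_fun setT Yhat)
  (Zhat_measurable : measurable_fun setT Zhat)
  (Yhat_limit : backward_limit P I F Yhat)
  (Zhat_limit : backward_limit P I G Zhat)
  (piF piG : probability R R)
  (piF_stationary : unique_stationary_law P I (F 0%N) piF)
  (piG_stationary : unique_stationary_law P I (G 0%N) piG)
  (thetaF thetaG : R)
  (thetaF_tail : is_tail_index piF thetaF)
  (thetaG_tail : is_tail_index piG thetaG) :
  let law_d0 : set R -> \bar R := pushforward P (fun w => mdist x0 (X0 w)) in
  [/\ forall t : R, 0 <= t ->
        (P [set w | (t < Yhat w)%R] <= P [set w | (t < mdist x0 (X0 w))%R]
           <= P [set w | (t < Zhat w)%R])%E,
      forall Xhat : Omega -> X,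
        measurable_fun setT (Xhat : Omega -> borel X) ->
        contractive P (@mdist R X) setT (fun n w => Psi (theta n w)) ->
        backward_limit P setT (fun n w => Psi (theta n w)) Xhat ->
        {ae P, forall w, Yhat w <= mdist x0 (Xhat w) <= Zhat w},
      exists theta_low theta_up : \bar R,
        [/\ is_lower_tail_index law_d0 theta_low,
            is_upper_tail_index law_d0 theta_up &
            [/\ thetaG%:E <= theta_low, theta_low <= theta_up &
                theta_up <= thetaF%:E]%E] &
      thetaF = thetaG ->
      is_exact_tail_index piF thetaF -> is_exact_tail_index piG thetaF ->
      is_exact_tail_index law_d0 thetaF].
Proof.
have mphiF : measurable_fun setT
    (fun s : random_map_space (setT : set X) (borel X) *
      random_map_space I R * random_map_space I R => s.1.2).
  exact: (measurableT_comp measurable_snd measurable_fst).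
have tailY t : P [set w | t < Yhat w] = piF [set x | t < x].
  exact: (tail_backward_limit C1_iid mphiF F_stable F_nondecreasing F_continuous
    (proj1 piF_stationary) t Yhat_measurable Yhat_limit).
have tailZ t : P [set w | t < Zhat w] = piG [set x | t < x].
  exact: (tail_backward_limit C1_iid measurable_snd G_stable G_nondecreasing
    G_continuous (proj1 piG_stationary) t Zhat_measurable Zhat_limit).
have sandwich : {ae P, forall w, forall n x,
    backward_iter (F^~ w) n (mdist x0 x) <=
    mdist x0 (backward_iter (fun j => Psi (theta j w)) n x) <=
    backward_iter (G^~ w) n (mdist x0 x)}.
  apply: filterS C2 => w FG n x; apply/andP; split.
    apply: (backward_iter_le_mdist I_nonneg (fun n => @F_stable n w))
      => [k s t|k y].
      exact: F_nondecreasing.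
    by have /andP[] := FG y k.
  apply: (mdist_le_backward_iter I_nonneg (fun n => @G_stable n w))
    => [k s t|k y].
    exact: G_nondecreasing.
  by have /andP[] := FG y k.
have tailX t : P [set w | t < mdist x0 (X0 w)] = pi [set x | t < mdist x0 x].
  by rewrite -X0_law//; exact: (measurable_gt_set t (measurable_mdist x0)).
pose V n (z : borel X * Omega) : borel X :=
  backward_iter (fun j => Psi (theta j z.2)) n z.1.
have mV n : measurable_fun setT (V n).
  exact: (measurable_backward theta_iid Psi_measurable).
have V_law n B : measurable B -> (pi \x P)%E [set z | B (V n z)] = pi B.
  by move=> mB; exact: (law_backward theta_iid Psi_measurable pi_stationary).
have comparison t : (P [set w | (t < Yhat w)%R] <=
    P [set w | (t < mdist x0 (X0 w))%R] <= P [set w | (t < Zhat w)%R])%E.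
  rewrite tailX; apply/andP; split.
    apply: (le_tail_eventually mV V_law Yhat_measurable (measurable_mdist x0)).
    apply: aeW => x; have := Yhat_limit _ (mdist_in x0 I_nonneg x).
    apply: filterS2 sandwich => w FG /cvgr_gt/[apply].
    apply: filterS => n /lt_le_trans; apply.
    by have /andP[] := FG n x.
  apply: (ge_tail_eventually mV V_law t Zhat_measurable (measurable_mdist x0)) => s.
  apply: aeW => x; have := Zhat_limit _ (mdist_in x0 I_nonneg x).
  apply: filterS2 sandwich => w FG /cvgr_lt/[apply]; apply: filterS => n.
  by apply: le_lt_trans; have /andP[] := FG n x.
move=> law_d0.
have FD : tail_dominated piF law_d0.
  move=> t t0; rewrite measure_ge0 /= set_itvoy -tailY /law_d0 /pushforward.
  by have /andP[] := comparison t.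
have DG : tail_dominated law_d0 piG.
  move=> t t0; rewrite set_itvoy -tailZ /law_d0 /pushforward measure_ge0 /=.
  by have /andP[] := comparison t.
split.
- by move=> t _; exact: comparison.
- move=> Xhat _ _ Xhat_limit.
  have Ix0 := mdist_in x0 I_nonneg x0.
  apply: filterS2 (filterI (Yhat_limit _ Ix0) (Zhat_limit _ Ix0))
    (filterI (Xhat_limit x0 Logic.I) sandwich) => w [limY limZ] [limX FG].
  have limd : mdist x0 (backward_iter (fun j => Psi (theta j w)) n x0)
      @[n --> \oo] --> mdist x0 (Xhat w).
    exact: (continuous_cvg _ (@continuous_mdist _ _ x0 (Xhat w)) limX).
  apply/andP; split.
    by apply: ler_cvg_to limY limd _; apply: nearW => n; have /andP[] := FG n x0.
  by apply: ler_cvg_to limd limZ _; apply: nearW => n; have /andP[] := FG n x0.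
- exact: tail_indices_between FD DG thetaF_tail thetaG_tail.
- by move=> _; exact: exact_tail_index_between FD DG.
Qed.
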